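(* Let $p,q,r$ be positive integers with $\gcd(p,q)=1$ and $\rho=\left(\frac{p}{q}\right)^{1/r}<1$, where $r$ is the smallest positive integer such that $\rho^{r}\in\mathbb{Q}$. Let $(N_n)_{n\ge 1}$ be a sequence of prime numbers with $M:=\sup\{N_n : n\ge 1\}<\infty$, let $\mathcal{D}_n=\{0,1,\ldots,N_n-1\}$, and let $\mu=\mu_{\rho,\{\mathcal{D}_n\}}=\delta_{\rho\mathcal{D}_1}*\delta_{\rho^2\mathcal{D}_2}*\delta_{\rho^3\mathcal{D}_3}*\cdots$ be the associated Moran measure. Then the following hold. (i) If $L^2(\mu)$ contains an infinite orthogonal set of exponential functions (i.e. there is an infinite set $\Lambda\subset\mathbb{R}$ such that $E_\Lambda$ is an orthogonal set in $L^2(\mu)$), then there exist infinitely many positive integers $n$ such that $\gcd(q,N_n)>1$. (ii) If $\gcd(q,N_n)=1$ and $\gcd(p,N_n)=1$ for all $n\ge 1$, then there are at most $M$ mutually orthogonal exponential functions in $L^2(\mu)$ (i.e. $\#\Lambda\le M$ whenever $E_\Lambda$ is an orthogonal set in $L^2(\mu)$), and $M$ is the best possible (i.e. there is $\Lambda\subset\mathbb{R}$ with $\#\Lambda=M$ such that $E_\Lambda$ is an orthogonal set in $L^2(\mu)$). (iii) If $\gcd(q,N_n)=1$ and $\gcd(p,N_n)>1$ for all $n\ge 1$, then there are any number of orthogonal exponential functions in $L^2(\mu)$, but not infinitely many: for every positive integer $\alpha$ there is $\Lambda\subset\mathbb{R}$ with $\#\Lambda=\alpha$ such that $E_\Lambda$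 is an orthogonal set in $L^2(\mu)$, while there is no infinite $\Lambda\subset\mathbb{R}$ such that $E_\Lambda$ is an orthogonal set in $L^2(\mu)$.
   Context: For a finite set $E\subset\mathbb{R}$, $\delta_E:=\frac{1}{\#E}\sum_{e\in E}\delta_e$, where $\delta_e$ is the Dirac measure at $e$ and $\#E$ is the cardinality of $E$. The infinite convolution defining $\mu$ is the weak limit of the finite convolutions $\delta_{\rho\mathcal{D}_1}*\cdots*\delta_{\rho^n\mathcal{D}_n}$; it is a compactly supported Borel probability measure on $\mathbb{R}$. For $\Lambda\subset\mathbb{R}$, $E_\Lambda=\{e^{2\pi i\lambda x}:\lambda\in\Lambda\}$. $E_\Lambda$ is an orthogonal set in $L^2(\mu)$ if $\int e^{2\pi i(\lambda-\lambda')x}\,d\mu(x)=0$ for all distinct $\lambda,\lambda'\in\Lambda$; equivalently $(\Lambda-\Lambda)\setminus\{0\}\subset\{\xi\in\mathbb{R}:\hat\mu(\xi)=0\}$, where $\hat\mu(\xi)=\int e^{-2\pi i\xi x}\,d\mu(x)$. *)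

(* Defs.v *)
From HB Require Import structures.
From mathcomp Require Import all_boot all_order all_algebra finmap complex.
From mathcomp Require Import all_classical all_reals all_analysis.

Set Implicit Arguments.
Unset Strict Implicit.
Unset Printing Implicit Defensive.

Import Order.TTheory GRing.Theory Num.Theory.
Import numFieldNormedType.Exports.

Local Open Scope classical_set_scope.
Local Open Scope ring_scope.

Section UniformMeasure.
Local Open Scope ereal_scope.
Context {R : realType} (E : {fset R}).
Local Notation T := (measurableTypeR R).

(* (1/#E) sum_(e in E) delta_e; the zero measure when E is empty. *)
Definition delta_fset (A : set T) : \bar R :=
  (#|` E|%:R^-1)%R%:E * \sum_(e <- E) \d_(e : T) A.

Let delta_fsetE : delta_fset =
  mscale ((#|` E|%:R^-1)%:nng)%R
    (msum (fun k => \d_(nth 0%R E k : T)) #|` E|).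
Proof.
by apply/funext => A; rewrite /delta_fset /mscale /msum (big_nth 0%R) big_mkord.
Qed.

Let delta_fset0 : delta_fset set0 = 0.
Proof. by rewrite delta_fsetE measure0. Qed.

Let delta_fset_ge0 A : 0 <= delta_fset A.
Proof. by rewrite delta_fsetE; exact: measure_ge0. Qed.

Let delta_fset_sigma_additive : semi_sigma_additive delta_fset.
Proof. by rewrite delta_fsetE; exact: measure_semi_sigma_additive. Qed.

HB.instance Definition _ := isMeasure.Build _ _ _ delta_fset
  delta_fset0 delta_fset_ge0 delta_fset_sigma_additive.

Let delta_fset_fin : fin_num_fun delta_fset.
Proof.
move=> A _; rewrite /delta_fset fin_numM// big_seq.
apply: (big_ind (fun x => x \is a fin_num)) => // x y ? ?.
by rewrite fin_numD; apply/andP.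
Qed.

HB.instance Definition _ :=
  @Measure_isFinite.Build _ _ _ delta_fset delta_fset_fin.

End UniformMeasure.

Section Convolution.
Local Open Scope ereal_scope.
Context {R : realType}.
Local Notation T := (measurableTypeR R).
Variables m1 m2 : {finite_measure set T -> \bar R}.

Definition convolution : set T -> \bar R :=
  pushforward (m1 \x m2) (fun z : T * T => (z.1 + z.2)%R : T).

Let measurable_add :
  measurable_fun [set: T * T] (fun z : T * T => (z.1 + z.2)%R : T).
Proof.
apply: measurable_realfun.measurable_funD.
- exact: measurable_fst.
- exact: measurable_snd.
Qed.

Let convolution0 : convolution set0 = 0.
Proof. by rewrite /convolution /pushforward preimage_set0 measure0. Qed.

Let convolution_ge0 A : 0 <= convolution A.
Proof. exact: measure_ge0. Qed.

Let convolution_sigma_additive : semi_sigma_additive convolution.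
Proof.
move=> F mF tF mUF; rewrite /convolution /pushforward preimage_bigcup.
apply: measure_semi_sigma_additive.
- by move=> n; rewrite -[X in measurable X]setTI; exact: measurable_add.
- apply/trivIsetP => /= i j _ _ ij; rewrite -preimage_setI.
  by move/trivIsetP : tF => /(_ _ _ _ _ ij) ->//; rewrite preimage_set0.
- by rewrite -preimage_bigcup -[X in measurable X]setTI; exact: measurable_add.
Qed.

HB.instance Definition _ := isMeasure.Build _ _ _ convolution
  convolution0 convolution_ge0 convolution_sigma_additive.

Let convolution_fin : fin_num_fun convolution.
Proof.
apply: lty_fin_num_fun; rewrite /= /convolution /pushforward.
rewrite preimage_setT -setXTT.
rewrite product_measure1E// lte_mul_pinfty ?fin_num_measure//.
by rewrite ltey_eq fin_num_measure.
Qed.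

HB.instance Definition _ :=
  @Measure_isFinite.Build _ _ _ convolution convolution_fin.

End Convolution.

Section MoranMeasure.
Context {R : realType}.
Local Notation T := (measurableTypeR R).

Definition digits (m : nat) : {fset R} := [fset k%:R | k in iota 0 m]%fset.

Definition dilate (a : R) (D : {fset R}) : {fset R} :=
  [fset a * d | d in D]%fset.

(* delta_(rho D_1) * ... * delta_(rho^n D_n), the empty convolution being the
   neutral element delta_0; the value D 0 is never used. *)
Fixpoint partial_convolution (rho : R) (D : nat -> {fset R}) (n : nat) :
    {finite_measure set T -> \bar R} :=
  match n with
  | 0 => \d_(0 : T)
  | m.+1 => convolution (partial_convolution rho D m)
                        (delta_fset (dilate (rho ^+ m.+1) (D m.+1)))
  end.

Definition weak_limit (m : nat -> {finite_measure set T -> \bar R})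
    (mu : probability T R) : Prop :=
  forall f : R -> R, continuous f -> bounded_fun f ->
    (\int[m n]_x f x)%R @[n --> \oo] --> (\int[mu]_x f x)%R.

Definition is_moran_measure (rho : R) (D : nat -> {fset R})
    (mu : probability T R) : Prop :=
  weak_limit (partial_convolution rho D) mu.

Definition expi (t : R) : R[i] := (cos t +i* sin t)%C.

Definition complex_integral (mu : probability T R) (f : R -> R[i]) : R[i] :=
  (\int[mu]_x complex.Re (f x) +i* \int[mu]_x complex.Im (f x))%C.

(* E_Lambda is an orthogonal set in L^2(mu). *)
Definition orthogonal_exponentials (mu : probability T R) (L : set R) : Prop :=
  forall l l' : R, L l -> L l' -> l != l' ->
    complex_integral mu (fun x => expi (2 * pi * (l - l') * x)) = 0.

End MoranMeasure.

(* Main.v *)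
Require Import Defs.
From HB Require Import structures.
From mathcomp Require Import all_boot all_order all_algebra finmap complex.
From mathcomp Require Import ring lra.
From mathcomp Require Import all_classical all_reals all_analysis.
Import Order.TTheory GRing.Theory Num.Theory.
Import numFieldNormedType.Exports.
Import measurable_realfun.
Local Open Scope classical_set_scope.
Local Open Scope card_scope.
Local Open Scope ring_scope.

(* The Fourier transform of mu is the infinite product of the means of
   exp(i t rho^n d) over the digits d < N_n, and the tail of this product stays
   away from 0; so it vanishes exactly at the t = rho^(-n) a / N_n with N_n not
   dividing a. By minimality of r, the numbers 1, rho, ..., rho^(r-1) are
   linearly independent over Q, so the differences of an orthogonal set share
   the class of n modulo r, and the problem becomes one about rationals
   (q/p)^j a / N_j.
   (i) If N_j is eventually prime to q, only finitely many points x of the set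
   have bounded j(x - x0) or j(x - x1), and any other x shows that x0 - x1 is
   divisible by a large power of q.
   (ii) Each difference has exactly one prime not dividing p in its denominator,
   looking at triangles that prime P is the same for all differences, and
   P (x - x0) modulo P tells the points apart.
   (iii) The points q^alpha / (p^i N_(ri)), with i <= alpha, are orthogonal because
   N_(ri) divides p. *)

(** * Zeros of the Fourier transform *)

Section Analysis.
Context {R : realType}.
Local Notation T := (measurableTypeR R).

(** * Integration against uniform measures and their convolutions *)

Lemma integral_delta_fset (E : {fset R}) (f : R -> R) :
  measurable_fun [set: T] (f : T -> R) ->
  (\int[delta_fset E]_x (f x)%:E)%E = ((#|` E|%:R)^-1 * \sum_(e <- E) f e)%:E.
Proof.
move=> mf.
pose m : nat -> {measure set T -> \bar R} := fun k => \d_(nth 0%R E k : T).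
(* The formula is proved first for nonnegative integrands, where a sum of measures can be integrated
   termwise without integrability; [f] is then split into its positive and negative parts. *)
have H (g : R -> \bar R) : measurable_fun [set: T] (g : T -> \bar R) ->
    (forall x, 0 <= g x)%E ->
    (\int[delta_fset E]_x g x = (#|` E|%:R^-1)%:E * \sum_(e <- E) g e)%E.
  move=> mg g0.
  transitivity (\int[mscale ((#|` E|%:R^-1)%:nng)%R (msum m #|` E|)]_x g x)%E.
    apply: eq_measure_integral => A mA _; rewrite /= /delta_fset /mscale /= /msum.
    by rewrite (big_nth 0%R) big_mkord.
  rewrite ge0_integral_mscale//=; congr (_ * _)%E.
  rewrite ge0_integral_measure_sum// (big_nth 0%R) big_mkord.
  apply: eq_bigr => i _; rewrite integral_dirac// diracT mul1e//.
have mE : measurable_fun [set: T] (fun x : T => (f x)%:E).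
  exact/measurable_EFinP.
rewrite integralE !H//; last 2 first.
- exact: measurable_funeneg.
- exact: measurable_funepos.
have HE (g : R -> \bar R) : (forall x, g x \is a fin_num) ->
   (\sum_(e <- E) g e = (\sum_(e <- E) fine (g e))%R%:E)%E.
  by move=> fg; rewrite -sumEFin; apply: eq_bigr => i _; rewrite fineK.
rewrite !HE; last 2 first.
- by move=> x; rewrite funenegE -EFinN -EFin_max.
- by move=> x; rewrite funeposE -EFin_max.
rewrite -!EFinM -EFinB -mulrBr -sumrB; congr (_ * _)%:E.
apply: eq_bigr => e _.
rewrite funeposE funenegE -EFinN -!EFin_max/=.
by case: (leP (f e)) => fe; case: (leP (- f e)); lra.
Qed.

(** Change of variables along the addition map, then Fubini; a bounded [f] is integrable because the
    measures are finite. *)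
Lemma integral_convolution (m : {finite_measure set T -> \bar R})
    (E : {fset R}) (f : R -> R) :
  measurable_fun [set: T] (f : T -> R) -> [bounded f x | x in [set: R]] ->
  (\int[convolution m (delta_fset E)]_x f x)%R =
  (#|` E|%:R)^-1 * \sum_(e <- E) (\int[m]_x f (x + e))%R.
Proof.
move=> mf bf.
have mD : measurable_fun [set: T * T] (fun z : T * T => (z.1 + z.2)%R : T).
  apply: measurable_realfun.measurable_funD.
  - exact: measurable_fst.
  - exact: measurable_snd.
have mDe e : measurable_fun [set: T] (fun x : T => (x + e)%R : T).
  by apply: measurable_realfun.measurable_funD.
have bcomp S (h : S -> R) : [bounded f (h x) | x in [set: S]].
  by case: bf => M [Mr HM]; exists M; split => // y /HM h1 x _; exact: h1.
have inte : (m \x delta_fset E)%E.-integrable setT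
   (EFin \o (fun z : T * T => f (z.1 + z.2))).
  apply: measurable_bounded_integrable => //.
  - have fin : ((m \x delta_fset E) ([set: T] `*` [set: T]) < +oo)%E.
      rewrite product_measure1E//.
      by rewrite lte_mul_pinfty ?fin_num_measure// ltey_eq fin_num_measure.
    by move: fin; rewrite setXTT.
  - exact: (measurableT_comp mf mD).
have intm e : m.-integrable setT (EFin \o (fun x : T => f (x + e))).
  apply: measurable_bounded_integrable => //.
  - by rewrite ltey_eq fin_num_measure.
  - exact: (measurableT_comp mf (mDe e)).
rewrite /Rintegral.
transitivity (fine (\int[pushforward (m \x delta_fset E)
   (fun z : T * T => (z.1 + z.2)%R : T)]_x (EFin \o f) x)%E); first by [].
rewrite integral_pushforward//; last first.
  exact/measurable_EFinP.
rewrite preimage_setT -integral12_prod_meas1//.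
under eq_integral => x _.
  rewrite /fubini_F /= integral_delta_fset; last first.
    apply: (measurableT_comp mf).
    by apply: measurable_realfun.measurable_funD.
  over.
under eq_integral => x _ do rewrite EFinM -sumEFin.
rewrite integralZl//; last first.
  by apply: integrable_sum => // e _; exact: intm.
rewrite integral_sum//.
set S := (X in (_ * X)%E).
have -> : S = (\sum_(e <- E) fine (\int[m]_x (f (x + e))%:E)%E)%:E.
  rewrite /S -sumEFin; apply: eq_bigr => e _.
  by rewrite fineK// integrable_fin_num//; exact: intm.
by [].
Qed.

(** * Fourier transforms of the finite convolutions, with kernel exp(itx) *)

Definition fourier (m : {finite_measure set T -> \bar R}) (t : R) : R[i] :=
  ((\int[m]_x cos (t * x))%R +i* (\int[m]_x sin (t * x))%R)%C.

Lemma expiD (s t : R) : expi (s + t) = expi s * expi t.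
Proof.
by rewrite /expi cosD sinD; apply/eqP; rewrite eq_complex /=; apply/andP; split;
  apply/eqP; ring.
Qed.

Lemma expi0 : expi 0 = 1 :> R[i].
Proof. by rewrite /expi cos0 sin0. Qed.

Lemma sum_expi (I : Type) (s : seq I) (f : I -> R) :
  \sum_(i <- s) expi (f i) =
  ((\sum_(i <- s) cos (f i))%R +i* (\sum_(i <- s) sin (f i))%R)%C.
Proof.
elim: s => [|a s IH]; first by rewrite !big_nil.
by rewrite !big_cons IH.
Qed.

Lemma continuous_cosM (t : R) : continuous (fun x : R => cos (t * x)).
Proof.
move=> x; apply: continuous_comp; last exact: continuous_cos.
by apply: cvgM; [exact: cvg_cst | exact: cvg_id].
Qed.

Lemma continuous_sinM (t : R) : continuous (fun x : R => sin (t * x)).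
Proof.
move=> x; apply: continuous_comp; last exact: continuous_sin.
by apply: cvgM; [exact: cvg_cst | exact: cvg_id].
Qed.

Lemma bounded_cosM (t : R) : bounded_fun (fun x : R => cos (t * x)).
Proof.
exists 1; split => // y y1 x _; apply: (le_trans _ (ltW y1)).
by rewrite ler_norml cos_geN1 cos_le1.
Qed.

Lemma bounded_sinM (t : R) : bounded_fun (fun x : R => sin (t * x)).
Proof.
exists 1; split => // y y1 x _; apply: (le_trans _ (ltW y1)).
by rewrite ler_norml sin_geN1 sin_le1.
Qed.

Lemma fourier_convolution (m : {finite_measure set T -> \bar R})
    (E : {fset R}) (t : R) :
  fourier (convolution m (delta_fset E)) t =
  fourier m t * ((#|` E|%:R^-1)%:C%C * \sum_(e <- E) expi (t * e)).
Proof.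
have mf (f : R -> R) : continuous f -> measurable_fun [set: T] (f : T -> R).
  by move=> cf; exact: continuous_measurable_fun.
have intf (f : R -> R) : continuous f -> bounded_fun f ->
    m.-integrable setT (EFin \o (f : T -> R)).
  move=> cf bf; apply: measurable_bounded_integrable => //; last exact: mf.
  by rewrite ltey_eq fin_num_measure.
have ic := intf _ (continuous_cosM t) (bounded_cosM t).
have is_ := intf _ (continuous_sinM t) (bounded_sinM t).
have intZ (f : R -> R) (k : R) : m.-integrable setT (EFin \o (f : T -> R)) ->
    m.-integrable setT (EFin \o (fun x : T => f x * k)).
  move=> fi; have := integrableZr measurableT k fi.
  by apply: eq_integrable => // x _; rewrite /= -EFinM.
have Mc := mf _ (continuous_cosM t).
have Ms := mf _ (continuous_sinM t).
have Bc := bounded_cosM t.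
have Bs := bounded_sinM t.
rewrite {1}/fourier !integral_convolution//.
rewrite sum_expi.
have -> : \sum_(e <- E) (\int[m]_x cos (t * (x + e)))%R =
   \sum_(e <- E) ((\int[m]_x cos (t * x))%R * cos (t * e) -
                  (\int[m]_x sin (t * x))%R * sin (t * e)).
  apply: eq_bigr => e _.
  under eq_Rintegral => x _ do rewrite mulrDr cosD.
  rewrite RintegralB//; [|exact: intZ|exact: intZ].
  by rewrite RintegralZr ?RintegralZr.
have -> : \sum_(e <- E) (\int[m]_x sin (t * (x + e)))%R =
   \sum_(e <- E) ((\int[m]_x sin (t * x))%R * cos (t * e) +
                  (\int[m]_x cos (t * x))%R * sin (t * e)).
  apply: eq_bigr => e _.
  under eq_Rintegral => x _ do rewrite mulrDr sinD.
  rewrite RintegralD//; [|exact: intZ|exact: intZ].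
  by rewrite RintegralZr ?RintegralZr.
rewrite sumrB big_split /= -!mulr_sumr /fourier.
by apply/eqP; rewrite eq_complex /=; apply/andP; split; apply/eqP; ring.
Qed.

(** The Fourier transform at [s] of the uniform measure on {0, ..., m-1}. *)
Definition digit_mean (m : nat) (s : R) : R[i] :=
  (m%:R^-1)%:C%C * \sum_(d < m) expi (s * d%:R).

Lemma fourier_partial_convolution (rho : R) (N : nat -> nat) (t : R) (n : nat) :
  0 < rho ->
  fourier (partial_convolution rho (fun k => digits (N k)) n) t =
  \prod_(k < n) digit_mean (N k.+1) (t * rho ^+ k.+1).
Proof.
move=> rho0; elim: n => [|n IH].
  rewrite big_ord0 /fourier /Rintegral /= !integral_dirac//.
  - by rewrite !diracT !mul1e /= mulr0 cos0 sin0.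
  - by apply/measurable_EFinP; apply: continuous_measurable_fun; exact: continuous_sinM.
  - by apply/measurable_EFinP; apply: continuous_measurable_fun; exact: continuous_cosM.
rewrite /= fourier_convolution IH big_ord_recr /=; congr (_ * _).
have inj1 : {in digits (N n.+1) &, injective (fun d : R => rho ^+ n.+1 * d)}.
  by move=> x y _ _; apply: mulfI; rewrite expf_neq0// gt_eqF.
have inj2 : {in iota 0 (N n.+1) &, injective (fun k : nat => k%:R : R)}.
  by move=> x y _ _ /eqP; rewrite eqr_nat => /eqP.
have sz : #|` dilate (rho ^+ n.+1) (digits (N n.+1))| = N n.+1.
  by rewrite card_in_imfset//= card_in_imfset//= undup_id ?iota_uniq ?size_iota.
rewrite sz /digit_mean; congr (_ * _).
rewrite big_imfset//= big_imfset//= undup_id ?iota_uniq//.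
rewrite -[X in iota X]/0%N -{1}(subn0 (N n.+1)) -/(index_iota 0 (N n.+1)) big_mkord.
by apply: eq_bigr => i _; rewrite mulrA.
Qed.

(** For the fractional part [z] of [y], cos(2 pi z) = 1 gives sin(pi z) = 0 by the double-angle
    formula, and sine is positive on (0, pi), so z = 0. *)
Lemma expi_eq1 (y : R) : expi (2 * pi * y) = 1 <-> exists a : int, y = a%:~R.
Proof.
have pn (f : R -> R) : periodic f (pi *+ 2) -> forall (a : int) x,
    f (x + 2 * pi * a%:~R) = f x.
  move=> pf; have H (k : nat) x : f (x + 2 * pi * k%:R) = f x.
    have -> : 2 * pi * k%:R = (pi *+ 2) *+ k :> R by rewrite mulr_natr mulr_natl.
    exact: periodicn.
  move=> [k|k] x; first exact: H.
  rewrite NegzE mulrNz mulrN -[in RHS](subrK (2 * pi * k.+1%:R) x).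
  by rewrite -pmulrn H.
split; last first.
  move=> [a ->]; rewrite -[2 * pi * _]add0r /expi.
  by rewrite !pn ?cos0 ?sin0//; [exact: sinD2pi | exact: cosD2pi].
move=> /eqP; rewrite eq_complex /= => /andP[/eqP c1 _].
exists (Num.floor y); set a := Num.floor y.
have ya : a%:~R <= y by exact: ge_floor.
have ya1 : y < a%:~R + 1 by have := floorD1_gt y; rewrite intrD.
set z := y - a%:~R.
have c2 : cos (2 * pi * z) = 1.
  rewrite -(pn _ (@cosD2pi R) a (2 * pi * z)) -[RHS]c1; congr cos.
  by rewrite /z mulrBr subrK.
have s0 : sin (pi * z) = 0.
  move: c2; rewrite (_ : 2 * pi * z = (pi * z) *+ 2); last by rewrite mulr2n; ring.
  rewrite cos_mulr2n cos2sin2 => H.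
  by apply/eqP; rewrite -sqrf_eq0; apply/eqP; move: H; rewrite mulr2n; lra.
have [z0|z0] := eqVneq z 0; first by move: z0; rewrite /z => /subr0_eq.
have pi0 := pi_gt0 R.
have : 0 < sin (pi * z).
  apply: sin_gt0_pi; have : 0 < z by rewrite lt_def z0 /z subr_ge0 ya.
  by move=> zp; rewrite mulr_gt0//= gtr_pMr// /z; move: ya1; lra.
by rewrite s0 ltxx.
Qed.

Lemma expiMn (s : R) (d : nat) : expi (s * d%:R) = expi s ^+ d.
Proof.
elim: d => [|d IH]; first by rewrite mulr0 expi0.
by rewrite exprSr -IH -expiD -natr1 mulrDr mulr1.
Qed.

(** With w = exp(2 pi i y), the mean is a geometric sum, and (w - 1) times this sum is w^m - 1. It
    vanishes exactly when w^m = 1 and w is not 1, that is, when m y is an integer and y is not. *)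
Lemma digit_mean_eq0 (m : nat) (y : R) : (0 < m)%N ->
  digit_mean m (2 * pi * y) = 0 <->
  exists a : int, ~~ (m %| a)%Z /\ y * m%:R = a%:~R.
Proof.
move=> m0.
have mR : m%:R != 0 :> R by rewrite pnatr_eq0 -lt0n.
have sumE : \sum_(d < m) expi (2 * pi * y * d%:R) =
    \sum_(d < m) expi (2 * pi * y) ^+ d.
  by apply: eq_bigr => d _; rewrite expiMn.
have dm0 : digit_mean m (2 * pi * y) = 0 <->
    \sum_(d < m) expi (2 * pi * y) ^+ d = 0.
  rewrite /digit_mean sumE; split => [/eqP|->]; last by rewrite mulr0.
  rewrite mulf_eq0 => /orP[|/eqP//].
  by rewrite eq_complex /= eqxx andbT invr_eq0 (negbTE mR).
have powE : expi (2 * pi * (y * m%:R)) - 1 =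
   (expi (2 * pi * y) - 1) * \sum_(d < m) expi (2 * pi * y) ^+ d.
  by rewrite -subrX1 -expiMn mulrA.
split.
- move=> /dm0 s0; move: powE; rewrite s0 mulr0 => /subr0_eq/expi_eq1[a ya].
  exists a; split => //; apply/negP => /dvdzP[b ab].
  have yb : y = b%:~R.
    by apply: (mulIf mR); rewrite ya ab intrM.
  move: s0; have /expi_eq1 -> : exists b : int, y = b%:~R by exists b.
  under eq_bigr do rewrite expr1n.
  rewrite sumr_const card_ord => /eqP.
  by rewrite pnatr_eq0; apply/negP; rewrite -lt0n.
- move=> [a [na ya]]; apply/dm0; move/eqP: powE.
  have /expi_eq1 -> : exists b : int, y * m%:R = b%:~R by exists a.
  rewrite subrr eq_sym mulf_eq0 => /orP[|/eqP//].
  rewrite subr_eq0 => /eqP/expi_eq1[b yb]; exfalso; move/negP: na; apply.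
  apply/dvdzP; exists b; apply/eqP; rewrite -(eqr_int R) -ya yb intrM.
  by [].
Qed.

(** * Lower bounds for the tail of the infinite product *)

Lemma cos_ge_1B (x : R) : 1 - `|x| <= cos x.
Proof.
wlog x0 : x / 0 <= x.
  move=> H; have [|/ltW x0] := leP 0 x; first exact: H.
  by have := H (- x); rewrite normrN cosN; apply; rewrite oppr_ge0.
rewrite ger0_norm//; move: x0; rewrite le_eqVlt => /predU1P[<-|x0].
  by rewrite cos0 subr0.
have [c _] := @MVT R cos (fun x => - sin x) 0 x x0
  (fun y _ => is_derive_cos y) (continuous_subspaceT (@continuous_cos R)).
rewrite cos0 subr0 => E.
have : sin c * x <= 1 * x by rewrite ler_pM2r// sin_le1.
by move: E; lra.
Qed.

(** The squared modulus kept as a real number: it is multiplicative and polynomial in the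
    coordinates, so limits can be taken in [R]. *)
Definition sqmod (z : R[i]) : R := complex.Re z ^+ 2 + complex.Im z ^+ 2.

Lemma sqmodM (z w : R[i]) : sqmod (z * w) = sqmod z * sqmod w.
Proof. by case: z => a b; case: w => c d; rewrite /sqmod /=; ring. Qed.

Lemma sqmod_prod (n : nat) (f : nat -> R[i]) :
  sqmod (\prod_(k < n) f k) = \prod_(k < n) sqmod (f k).
Proof.
elim: n => [|n IH]; last by rewrite !big_ord_recr /= sqmodM IH.
by rewrite !big_ord0 /sqmod /=; ring.
Qed.

Lemma sqmod_gt0 (z : R[i]) : (0 < sqmod z) = (z != 0).
Proof.
case: z => a b; rewrite eq_complex /= /sqmod /= lt_def addr_ge0 ?sqr_ge0// andbT.
by rewrite paddr_eq0 ?sqr_ge0// !sqrf_eq0.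
Qed.

(** The real part suffices: each argument s d has d < m <= M, so each cosine is at least 1 - M|s|,
    uniformly in [m]. *)
Lemma sqmod_digit_mean_ge (M m : nat) (s : R) : (0 < m <= M)%N ->
  M%:R * `|s| <= 1 -> (1 - M%:R * `|s|) ^+ 2 <= sqmod (digit_mean m s).
Proof.
move=> /andP[m0 mM] Ms.
have mR : 0 < m%:R :> R by rewrite ltr0n.
have Re_ge : 1 - M%:R * `|s| <= complex.Re (digit_mean m s).
  rewrite /digit_mean sum_expi /= mul0r subr0 -ler_pdivrMl ?invr_gt0// invrK.
  have -> : m%:R * (1 - M%:R * `|s|) = \sum_(d < m) (1 - M%:R * `|s|).
    by rewrite sumr_const card_ord mulr_natl.
  apply: ler_sum => d _; apply: le_trans (cos_ge_1B _).
  rewrite lerD2l lerN2 normrM mulrC ler_wpM2r// normr_nat ler_nat.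
  by apply: leq_trans mM; apply: ltnW.
rewrite /sqmod -[leLHS]addr0 lerD ?sqr_ge0//.
by rewrite ler_sqr// nnegrE; move: Ms Re_ge; lra.
Qed.

(** The Weierstrass inequality prod (1 - u_i) >= 1 - sum u_i for u_i = D (1 - x) x^i, whose partial
    sums are D (1 - x^j). *)
Lemma prod_geometric_ge (x D : R) (a : nat -> R) (j : nat) :
  0 < x < 1 -> 0 <= D <= 1 ->
  (forall i, 1 - D * (1 - x) * x ^+ i <= a i) ->
  1 - D * (1 - x ^+ j) <= \prod_(i < j) a i.
Proof.
move=> /andP[x0 x1] /andP[D0 D1] ha; elim: j => [|j IH].
  by rewrite big_ord0 expr0 subrr mulr0 subr0.
rewrite big_ord_recr /=.
have xj0 : 0 < x ^+ j by rewrite exprn_gt0.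
have xj1 : x ^+ j <= 1 by rewrite exprn_ile1// ltW.
have u0 : 0 <= D * (1 - x ^+ j) by rewrite mulr_ge0// subr_ge0.
have v0 : 0 <= D * (1 - x) * x ^+ j.
  by rewrite !mulr_ge0 ?subr_ge0 ?(ltW x1) ?(ltW xj0).
have w1 : D * (1 - x ^+ j) <= 1 by have := mulr_ge0 D0 (ltW xj0); lra.
have y0 : 0 <= D * (1 - x) by rewrite mulr_ge0// subr_ge0 ltW.
have y1 : D * (1 - x) <= 1 by have := mulr_ge0 D0 (ltW x0); lra.
have z1 : D * (1 - x) * x ^+ j <= 1 by rewrite mulr_ile1// ltW.
apply: (@le_trans _ _ ((1 - D * (1 - x ^+ j)) * (1 - D * (1 - x) * x ^+ j))).
  have := mulr_ge0 u0 v0; rewrite exprS; set X := x ^+ j; nra.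
by apply: ler_pM => //; rewrite ?subr_ge0.
Qed.

Definition moran_zero (rho : R) (N : nat -> nat) (t : R) : Prop :=
  exists n (a : int), [/\ (0 < n)%N, ~~ (N n %| a)%Z &
                          t * rho ^+ n * (N n)%:R = a%:~R].

Section MoranZeros.
Variables (rho : R) (N : nat -> nat) (M : nat).
Hypotheses (rho0 : 0 < rho) (rho1 : rho < 1).
Hypothesis NM : forall n, (0 < n)%N -> (1 < N n <= M)%N.
Variable mu : probability T R.
Hypothesis hmu : is_moran_measure rho (fun n => digits (N n)) mu.

Local Notation F t k := (digit_mean (N k.+1) (t * rho ^+ k.+1)).

Lemma sqmod_partial_product_ge (t : R) : (forall k, F t k != 0) ->
  exists2 c, 0 < c & \forall n \near \oo, c <= sqmod (\prod_(k < n) F t k).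
Proof.
move=> F0.
(* With D = C rho^(K+1), the quantity M |t| rho^(K+i+1) governing the tail equals D (1 - rho) rho^i,
   the shape required by [prod_geometric_ge]. The choice of [K] makes D at most 1/2, so the product
   of the [a i] is at least 1/2; squaring it gives the 1/4. *)
pose C := M%:R * `|t| / (1 - rho).
have C0 : 0 <= C by rewrite /C mulr_ge0 ?mulr_ge0// invr_ge0 subr_ge0 ltW.
have [K HK] : exists K, C * rho ^+ K.+1 <= 2^-1.
  have : C \*o (fun k => rho ^+ k) @ \oo --> C * 0.
    by apply: cvgMr; apply: cvg_expr; rewrite gtr0_norm.
  rewrite mulr0 => /cvgrPdist_le/(_ 2^-1)[|n _ Hn]; first by rewrite invr_gt0.
  exists n; have := Hn n.+1 (leqnSn n).
  by rewrite sub0r normrN; apply: le_trans; rewrite ler_norm.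
pose D := C * rho ^+ K.+1.
have D0 : 0 <= D by rewrite /D mulr_ge0// exprn_ge0// ltW.
have D1 : D <= 1 by apply: (le_trans HK); rewrite invf_le1//; lra.
pose P := \prod_(k < K) sqmod (F t k).
have P0 : 0 < P by apply: prodr_gt0 => k _; rewrite sqmod_gt0.
exists (P * 4^-1); first by rewrite mulr_gt0// invr_gt0.
exists K => // n /= Kn.
rewrite (sqmod_prod n (fun k => F t k)) -(subnKC Kn) big_split_ord /=.
rewrite ler_wpM2l//; first exact: ltW.
set j := (n - K)%N.
pose a i := 1 - D * (1 - rho) * rho ^+ i.
have eD i : D * (1 - rho) * rho ^+ i = M%:R * `|t * rho ^+ (K + i).+1|.
  have r1 : 1 - rho != 0 by rewrite subr_eq0 gt_eqF.
  rewrite /D /C normrM (ger0_norm (exprn_ge0 _ (ltW rho0))) -addSn exprD.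
  by field.
have eD1 i : D * (1 - rho) * rho ^+ i <= 1.
  have y0 : 0 <= D * (1 - rho) by rewrite mulr_ge0// subr_ge0 ltW.
  have y1 : D * (1 - rho) <= 1 by have := mulr_ge0 D0 (ltW rho0); lra.
  by rewrite mulr_ile1// ?exprn_ge0 ?exprn_ile1 ?ltW.
apply: (@le_trans _ _ (\prod_(i < j) (a i) ^+ 2)); last first.
  apply: ler_prod => i _; rewrite sqr_ge0/= /a eD.
  apply: sqmod_digit_mean_ge; last by rewrite -eD.
  have /andP[h1 ->] := NM _ (ltn0Sn (K + i)).
  by rewrite (ltnW h1).
rewrite prodrXl.
have : 1 - D * (1 - rho ^+ j) <= \prod_(i < j) a i.
  by apply: prod_geometric_ge; rewrite ?rho0 ?D0.
have : 0 <= rho ^+ j by rewrite exprn_ge0// ltW.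
set X := rho ^+ j; set Y := \prod_(i < j) _ => X0 H.
have Y2 : 2^-1 <= Y.
  have := mulr_ge0 D0 X0; move: HK H; rewrite -/D; lra.
have : (2^-1) ^+ 2 <= Y ^+ 2 by rewrite ler_sqr// nnegrE; lra.
by apply: le_trans; lra.
Qed.

(** Weak convergence, tested on cosine and sine, makes the transform of [mu] the limit of the
    partial products. These are eventually 0 if some factor vanishes, and stay away from 0
    otherwise. *)
Lemma fourier_limit_eq0 (t : R) :
  complex_integral mu (fun x => expi (t * x)) = 0 <->
  exists2 n : nat, (0 < n)%N & digit_mean (N n) (t * rho ^+ n) = 0.
Proof.
pose mun := partial_convolution rho (fun n => digits (N n)).
have cc := hmu _ (continuous_cosM t) (bounded_cosM t).
have cs := hmu _ (continuous_sinM t) (bounded_sinM t).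
have munE n : sqmod (fourier (mun n) t) = sqmod (\prod_(k < n) F t k).
  by rewrite /mun fourier_partial_convolution.
have csq : sqmod (\prod_(k < n) F t k) @[n --> \oo] -->
    sqmod (complex_integral mu (fun x => expi (t * x))).
  under eq_cvg => n do rewrite -munE.
  exact: (cvgD (cvgM cc cc) (cvgM cs cs)).
split.
- move=> E0; apply: contrapT => nex.
  have [k|c c0 cle] := sqmod_partial_product_ge t.
    by apply/eqP => Fk; apply: nex; exists k.+1.
  have : c <= sqmod (complex_integral mu (fun x => expi (t * x))).
    exact: (cvgr_to_ge csq cle).
  by rewrite E0 /sqmod /= expr0n addr0 leNgt c0.
- move=> [[//|k] _ Fk]; apply/eqP; rewrite -[_ == 0]negbK -sqmod_gt0 -leNgt.
  apply: (cvgr_to_le csq); exists k.+1 => // n /= kn.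
  rewrite (bigD1 (Ordinal kn)) //= Fk mul0r /sqmod /=.
  by rewrite expr0n addr0.
Qed.

Lemma moran_fourier_eq0 (t : R) :
  complex_integral mu (fun x => expi (2 * pi * t * x)) = 0 <->
  moran_zero rho N t.
Proof.
rewrite fourier_limit_eq0; split.
- move=> [n n0]; rewrite -mulrA => /digit_mean_eq0[|a [na ta]]; last by exists n, a.
  by have /andP[/ltnW] := NM _ n0.
- move=> [n [a [n0 na ta]]]; exists n => //; rewrite -mulrA; apply/digit_mean_eq0.
    by have /andP[/ltnW] := NM _ n0.
  by exists a.
Qed.
End MoranZeros.
End Analysis.

(** * Reduction to rational numbers *)

Section Radical.
Context {R : realType}.

Lemma real_complex_ratr (x : rat) : (ratr x : R)%:C%C = ratr x :> R[i].
Proof.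
exact: (fmorph_eq_rat (real_complex R \o (@ratr R)) x).
Qed.

(* A rational factor of X^r - c has, up to its leading coefficient, a constant
   term of modulus rho^d with d its degree, since all its complex roots have
   modulus rho; so it has degree at least r. *)
Lemma radical_root_size (c : rat) (r : nat) (rho : R) (P : {poly rat}) :
  0 < rho -> rho ^+ r = ratr c ->
  (forall k : nat, (0 < k < r)%N -> ~ rational (rho ^+ k)) ->
  P != 0 -> root (map_poly ratr P) rho -> (r < size P)%N.
Proof.
move=> rho0 rhor hr P0 Prho; rewrite ltnNge; apply/negP => sP.
have r0 : (0 < r)%N by apply: leq_trans sP; rewrite lt0n size_poly_eq0.
pose B : {poly rat} := 'X^r - c%:P.
(* The gcd with X^r - c keeps the root [rho] and a degree below [r], and forces every complex root
   to have modulus [rho]. *)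
pose g := gcdp P B.
have g0 : g != 0 by rewrite gcdp_eq0 negb_and P0.
have groot : root (map_poly ratr g) rho.
  rewrite gcdp_map root_gcd Prho /= /root /B rmorphB /= map_polyXn map_polyC /=.
  by rewrite !hornerE rhor subrr.
have sg : (size g <= r)%N by apply: leq_trans sP; apply: dvdp_leq => //; exact: dvdp_gcdl.
pose G : {poly R[i]} := map_poly ratr g.
have G0 : G != 0 by rewrite map_poly_eq0.
have sG : size G = size g by rewrite size_map_poly.
have sg1 : (1 < size g)%N.
  by rewrite -(size_map_poly (@ratr R)) (root_size_gt1 _ groot)// map_poly_eq0.
have [s Gs] := closed_field_poly_normal G.
have sizes : (size s).+1 = size g.
  by rewrite -sG Gs size_scale ?lead_coef_eq0// size_prod_XsubC.
have normz z : z \in s -> `|z| = rho%:C%C.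
  move=> zs; have zG : root G z by rewrite Gs rootZ ?lead_coef_eq0// root_prod_XsubC.
  have /dvdpP[h Bh] : g %| B by exact: dvdp_gcdr.
  have : root (map_poly (@ratr R[i]) B) z by rewrite Bh rmorphM /= rootM zG orbT.
  rewrite /root /B rmorphB /= map_polyXn map_polyC /= !hornerE subr_eq0 => /eqP zr.
  have : `|z| ^+ r = rho%:C%C ^+ r.
    rewrite -normrX zr -real_complex_ratr -rhor normc_def /= expr0n addr0 sqrtr_sqr.
    by rewrite ger0_norm ?exprn_ge0 ?(ltW rho0)// rmorphXn.
  move/eqP; rewrite eqrXn2//; first by move/eqP.
  by rewrite lecR ltW.
have G00 : `|G.[0]| = `|lead_coef G| * (rho ^+ size s)%:C%C.
  rewrite {1}Gs hornerZ normrM horner_prod normr_prod; congr (_ * _).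
  rewrite big_seq (eq_bigr (fun=> rho%:C%C)) -?big_seq; last first.
    by move=> z zs; rewrite hornerXsubC sub0r normrN normz.
  by rewrite big_const_seq count_predT iter_mulr_1 rmorphXn.
have lG : lead_coef G = ratr (lead_coef g) by rewrite lead_coef_map.
have hG : G.[0] = ratr g.[0] by rewrite -(rmorph0 (@ratr R[i])) horner_map.
apply: (hr (size s)); first by rewrite sizes sg andbT -ltnS sizes.
exists (`|g.[0]| / `|lead_coef g|) => //.
have l0 : `|lead_coef G| != 0 by rewrite normr_eq0 lead_coef_eq0.
apply: (@complexI R); rewrite real_complex_ratr fmorph_div /=.
rewrite !ratr_norm -hG -lG G00 mulrAC divff ?mul1r//.
Qed.

Section Reduction.
Variables (c : rat) (r : nat) (rho : R).
Hypotheses (r0 : (0 < r)%N) (c0 : c != 0) (rho0 : 0 < rho).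
Hypothesis rhor : rho ^+ r = ratr c.
Hypothesis hr : forall k : nat, (0 < k < r)%N -> ~ rational (rho ^+ k).

Lemma radical_expE (n : nat) : rho ^+ n = ratr (c ^+ (n %/ r)) * rho ^+ (n %% r).
Proof. by rewrite {1}(divn_eq n r) exprD mulnC exprM rhor rmorphXn. Qed.

(** Reducing exponents modulo [r] gives a polynomial of degree less than [r] with root [rho], hence
    the zero polynomial. If i and j were distinct modulo [r], the C term could cancel only one of
    the other two. *)
Lemma radical_three_term (A B C : rat) (i j k : nat) :
  A != 0 -> B != 0 ->
  ratr A * rho ^+ i = ratr B * rho ^+ j + ratr C * rho ^+ k ->
  i = j %[mod r].
Proof.
move=> A0 B0.
have H (D : rat) m : ratr D * rho ^+ m = ratr (D * c ^+ (m %/ r)) * rho ^+ (m %% r).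
  by rewrite radical_expE rmorphM -[RHS]mulrA.
rewrite (H A) (H B) (H C) {H}.
set A' := A * _; set B' := B * _; set C' := C * _ => E.
have A'0 : A' != 0 by rewrite mulf_neq0 ?expf_neq0.
have B'0 : B' != 0 by rewrite mulf_neq0 ?expf_neq0.
pose P : {poly rat} := A' *: 'X^(i %% r) - B' *: 'X^(j %% r) - C' *: 'X^(k %% r).
have sX (D : rat) m : (size (D *: 'X^(m %% r)) <= r)%N.
  by apply: leq_trans (size_scale_leq _ _) _; rewrite size_polyXn ltn_mod.
have sP : (size P <= r)%N.
  rewrite /P; apply: leq_trans (size_polyD _ _) _; rewrite size_polyN geq_max sX andbT.
  by apply: leq_trans (size_polyD _ _) _; rewrite size_polyN geq_max !sX.
have rP : root (map_poly ratr P) rho.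
  rewrite /root /P !rmorphB /= !linearZ /= !map_polyXn !hornerE.
  by rewrite E !mulrN -addrA -opprD subrr.
have P0 : P = 0.
  apply/eqP/negPn/negP => P0.
  by have := radical_root_size _ _ _ _ rho0 rhor hr P0 rP; rewrite ltnNge sP.
apply/eqP/negPn/negP => ij.
have := congr1 (fun Q : {poly rat} => Q`_(i %% r)) P0.
have := congr1 (fun Q : {poly rat} => Q`_(j %% r)) P0.
rewrite /P !coefE eqxx /= [(j %% r == i %% r)%N]eq_sym (negbTE ij) /= eqxx.
have [<-|_] := eqVneq (i %% r)%N (k %% r)%N.
  rewrite [(j %% r == i %% r)%N]eq_sym (negbTE ij) /=.
  by rewrite !mulr0 subr0 sub0r mulr1 => /eqP; rewrite oppr_eq0 (negbTE B'0).
by move=> _; rewrite !mulr0 !subr0 mulr1 => /eqP; rewrite (negbTE A'0).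
Qed.

Variable N : nat -> nat.
Hypothesis N0 : forall n, (0 < n)%N -> (0 < N n)%N.

(* The rationals z with rho^(-s) z a zero at an index n = j r + s. *)
Definition moran_zero_class (s : nat) (z : rat) : Prop :=
  exists j (a : int), [/\ (0 < j * r + s)%N, ~~ (N (j * r + s) %| a)%Z &
                          z * c ^+ j * (N (j * r + s))%:R = a%:~R].

(** Two points l0 and l1 fix the class: for every l in L, the difference l - l0 belongs to an index
    congruent to that of l1 - l0, so L lies in l0 + rho^(-s) Q. The set [X] is L in this rational
    coordinate. *)
Lemma moran_zero_single_class (L : set R) :
  (exists l l', [/\ L l, L l' & l != l']) ->
  (forall l l', L l -> L l' -> l != l' -> moran_zero rho N (l - l')) ->
  exists s (X : set rat), X #= L /\
    forall x y, X x -> X y -> x != y -> moran_zero_class s (x - y).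
Proof.
move=> [l0 [l1 [L0 L1 l01]]] hL.
have nz n (a : int) : ~~ (N n %| a)%Z -> a != 0.
  by apply: contraNneq => ->; rewrite dvdz0.
have rn0 n : rho ^+ n != 0 by rewrite expf_neq0// gt_eqF.
have NR n : (0 < n)%N -> (N n)%:R != 0 :> R.
  by move=> /N0; rewrite pnatr_eq0 lt0n.
have NQ n : (0 < n)%N -> (N n)%:R != 0 :> rat.
  by move=> /N0; rewrite pnatr_eq0 lt0n.
have [n1 [a1 [n10 na1 e1]]] : moran_zero rho N (l1 - l0) by apply: hL; rewrite 1?eq_sym.
pose s := (n1 %% r)%N.
pose f (y : rat) := l0 + rho ^- s * ratr y.
have finj : injective f.
  move=> x y /addrI/mulfI; rewrite invr_eq0 rn0 => /(_ isT).
  exact: fmorph_inj.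
have key l n (a : int) : (0 < n)%N -> n = n1 %[mod r] ->
    (l - l0) * rho ^+ n * (N n)%:R = a%:~R -> exists y, f y = l.
  move=> n0 nn1 e; exists (a%:~R / (N n)%:R / c ^+ (n %/ r)).
  have c1 : ratr c ^+ (n %/ r) != 0 :> R by rewrite expf_neq0// fmorph_eq0.
  rewrite /f -[RHS](subrK l0) addrC; congr (_ + _).
  apply: (mulIf (NR _ n0)); apply: (mulIf (rn0 n)).
  rewrite [RHS]mulrAC e !fmorph_div /= ratr_int ratr_nat rmorphXn /=.
  rewrite (radical_expE n) nn1 -/s rmorphXn /=.
  by field; rewrite NR// c1 rn0.
have cls l : L l -> exists n (a : int), [/\ (0 < n)%N, n = n1 %[mod r] &
    (l - l0) * rho ^+ n * (N n)%:R = a%:~R].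
  move=> Ll; have [->|ll0] := eqVneq l l0.
    by exists n1, 0; rewrite subrr !mul0r.
  have [->|ll1] := eqVneq l l1; first by exists n1, a1.
  have [n [a [n0 na e]]] := hL _ _ Ll L0 ll0.
  have [n2 [a2 [n20 na2 e2]]] := hL _ _ Ll L1 ll1.
  exists n, a; split => //.
  (* The identity l - l0 = (l1 - l0) + (l - l1), multiplied by rho^(n + n1 + n2), is a three-term
     relation with rational coefficients. *)
  have : (n1 + n2 = n + n2 %[mod r])%N.
    apply: (@radical_three_term (a%:~R / (N n)%:R) (a1%:~R / (N n1)%:R)
      (a2%:~R / (N n2)%:R) _ _ (n + n1)%N).
    - by rewrite mulf_neq0 ?invr_eq0 ?NQ// intr_eq0 (nz n).
    - by rewrite mulf_neq0 ?invr_eq0 ?NQ// intr_eq0 (nz n1).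
    - rewrite !fmorph_div /= !ratr_int !ratr_nat -e -e1 -e2 !exprD.
      by field; rewrite !NR.
  by move/eqP; rewrite eqn_modDr => /eqP.
exists s, [set y | L (f y)]; split.
  have LE : L = f @` [set y | L (f y)].
    apply/seteqP; split => [l Ll|_ [y Ly <-]//].
    have [n [a [n0 nn1 e]]] := cls _ Ll.
    by have [y fy] := key _ _ _ n0 nn1 e; exists y => //=; rewrite fy.
  rewrite [X in _ #= X]LE card_eq_sym; apply: inj_card_eq => x y _ _.
  exact: finj.
move=> x y /= Lx Ly xy.
have fxy0 : f x != f y by rewrite (inj_eq finj).
have [n [a [n0 na e]]] := hL _ _ Lx Ly fxy0.
have fxy : f x - f y = rho ^- s * ratr (x - y).
  by rewrite /f rmorphB /= mulrBr; ring.
rewrite fxy in e.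
(* This relation has only two terms; its right-hand side is halved to fit the three-term lemma. *)
have ns : (n = s %[mod r])%N.
  apply: (@radical_three_term ((x - y) * (N n)%:R) (a%:~R / 2) (a%:~R / 2) _ _ s).
  - by rewrite mulf_neq0 ?NQ// subr_eq0.
  - by rewrite mulf_neq0// intr_eq0 (nz n).
  - rewrite fmorph_div rmorphM /= ratr_int !ratr_nat -e.
    by field; rewrite rn0.
have nE : n = (n %/ r * r + s)%N.
  by rewrite {1}(divn_eq n r) ns /s modn_mod.
exists (n %/ r)%N, a; rewrite -nE; split => //.
apply: (fmorph_inj (@ratr R)); rewrite !rmorphM /= rmorphXn ratr_int ratr_nat /= -e.
rewrite [rho ^+ n]radical_expE ns modn_mod rmorphXn /=.
by field; rewrite rn0.
Qed.
End Reduction.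
End Radical.

(** * Denominators of differences *)

Section Rationals.

Lemma card_le_inj_on (T U : Type) (A : set T) (B : set U) (f : T -> U) :
  {in A &, injective f} -> (forall x, A x -> B (f x)) -> A #<= B.
Proof.
move=> /inj_card_eq fA AB; apply: (@card_le_trans _ _ _ (f @` A)).
  by move: fA; rewrite card_eq_le => /andP[].
by apply: subset_card_le => _ [x Ax <-]; exact: AB.
Qed.

Lemma card_le_subsingleton (T : eqType) (A : set T) (m : nat) : (0 < m)%N ->
  ~ (exists x y, [/\ A x, A y & x != y]) -> A #<= `I_m.
Proof.
move=> m0 nA; apply: (@card_le_inj_on _ _ _ _ (fun=> 0%N)) => //.
move=> x y /set_mem Ax /set_mem Ay _; apply/eqP/negPn/negP => xy.
by apply: nA; exists x, y.
Qed.

Lemma dvdz_primeM (P : nat) (m n : int) : prime P ->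
  (P %| m * n)%Z = (P %| m)%Z || (P %| n)%Z.
Proof. by move=> Pp; rewrite !dvdzE abszM Euclid_dvdM. Qed.

Lemma Posz_exp (m j : nat) : (m ^ j)%N%:Z = m%:Z ^+ j.
Proof. by elim: j => // j IH; rewrite expnS PoszM IH exprS. Qed.

Lemma dvdz_primeX (P m j : nat) : prime P -> (P %| m%:Z ^+ j)%Z -> (P %| m)%N.
Proof.
by move=> Pp; rewrite -Posz_exp dvdzE /= Euclid_dvdX// => /andP[].
Qed.

(** If x D and y D agree modulo m D, then x - y is an integer multiple of m, which is excluded for
    distinct points; so at most m D points have denominator dividing D. *)
Lemma finite_bounded_denominator (X : set rat) (D m : nat) : (0 < D)%N -> (0 < m)%N ->
  (forall x y, X x -> X y -> x != y -> forall b : int, x - y != m%:R * b%:~R) ->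
  finite_set (X `&` [set x | x * D%:R \is a Num.int]).
Proof.
move=> D0 m0 hX.
pose g (x : rat) := `|(numq (x * D%:R) %% (m * D)%N)%Z|%N.
have mD : (0 < m * D)%N by rewrite muln_gt0 m0.
have mD0 : (m * D)%N%:Z != 0 by rewrite eqz_nat -lt0n.
apply: (card_le_finite (B := `I_(m * D)) _ (finite_II _)).
apply: (@card_le_inj_on _ _ _ _ g).
  move=> x y /set_mem[Xx /intrP[a xa]] /set_mem[Xy /intrP[b yb]].
  rewrite /g xa yb !numq_int => /(congr1 Posz).
  rewrite !gez0_abs ?modz_ge0// => /eqP; rewrite eqz_mod_dvd => /dvdzP[k abk].
  apply/eqP/negPn/negP => /(hX _ _ Xx Xy)/(_ k)/negP; apply; apply/eqP.
  have DR : D%:R != 0 :> rat by rewrite pnatr_eq0 -lt0n.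
  apply: (mulIf DR); rewrite mulrBl xa yb -intrB abk intrM PoszM intrM.
  by rewrite mulrC -!pmulrn; ring.
move=> x _ /=; rewrite /g -ltz_nat gez0_abs ?modz_ge0//.
by apply: ltz_pmod; rewrite ltz_nat.
Qed.

Section Classes.
Variables (p q r s : nat) (N : nat -> nat) (M : nat).
Hypotheses (p0 : (0 < p)%N) (q1 : (1 < q)%N) (r0 : (0 < r)%N) (pq : coprime p q).
Hypothesis Np : forall n, (0 < n)%N -> prime (N n).
Hypothesis NM : forall n, (0 < n)%N -> (N n <= M)%N.

Local Notation c := (p%:R / q%:R : rat).
Local Notation K j := (N (j * r + s)).

Lemma moran_zero_class_clear (z : rat) (j : nat) (a : int) :
  z * c ^+ j * (K j)%:R = a%:~R ->
  z * (p%:Z ^+ j * (K j)%:Z)%:~R = (q%:Z ^+ j * a)%:~R.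
Proof.
have qR : q%:R ^+ j != 0 :> rat by rewrite expf_neq0// pnatr_eq0 -lt0n ltnW.
rewrite !intrM => <-; rewrite !rmorphXn /= -!pmulrn expr_div_n.
by field.
Qed.

Lemma moran_zero_class_finite (X : set rat) (n0 : nat) :
  (forall n, (n0 < n)%N -> coprime q (N n)) ->
  (forall x y, X x -> X y -> x != y -> moran_zero_class c r N s (x - y)) ->
  finite_set X.
Proof.
move=> Nq hX; apply: contrapT => infX.
have q0 : (0 < q)%N := ltnW q1.
pose J0 := n0.+1.
have idx j : (J0 <= j)%N -> (n0 < j * r + s)%N.
  move=> Jj; apply: (leq_trans Jj); apply: leq_trans (leq_addr _ _).
  by rewrite leq_pmulr.
(* For a zero of index j >= J0, the prime N_n divides q^j a but not q, hence divides a; for j < J0,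
   cancelling q^j shows directly that it divides a. Both are excluded. *)
have nodiv x y : X x -> X y -> x != y -> forall b : int,
    x - y != (q ^ J0)%:R * b%:~R.
  move=> Xx Xy xy b; apply/eqP => xyb.
  have [j [a [j0 na /moran_zero_class_clear]]] := hX _ _ Xx Xy xy.
  rewrite xyb pmulrn -!intrM => /eqP; rewrite eqr_int Posz_exp => /eqP e.
  have qz k : q%:Z ^+ k != 0 by rewrite expf_neq0// eqz_nat -lt0n.
  move/negP: na; apply; have [Jj|jJ] := leqP J0 j.
    have : (K j %| q%:Z ^+ j * a)%Z by rewrite -e mulrA dvdz_mull.
    rewrite dvdz_primeM ?Np// => /orP[/dvdz_primeX|//].
    move=> /(_ (Np _ j0)) Kq; have := Nq _ (idx _ Jj).
    by rewrite coprime_sym prime_coprime ?Np// Kq.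
  have -> : a = q%:Z ^+ (J0 - j) * b * p%:Z ^+ j * (K j)%:Z.
    apply: (mulfI (qz j)); rewrite -e -{1}(subnKC (ltnW jJ)) exprD.
    by ring.
  by rewrite dvdz_mull.
(* Points reached from [x0] with index at most [J]. They share a denominator built from that of
   [x0], from p^J and from M!, a common multiple of all N_n, so there are finitely many of them. *)
pose near_ J x0 := [set x | X x /\ (x = x0 \/ exists j (a : int),
   [/\ (j <= J)%N, (0 < j * r + s)%N & (x - x0) * c ^+ j * (K j)%:R = a%:~R])].
have near_fin J x0 : finite_set (near_ J x0).
  pose d := `|denq x0|%N.
  have d0 : (0 < d)%N by rewrite absz_gt0 denq_eq0.
  apply: sub_finite_set (@finite_bounded_denominator X
      (d * (p ^ J * M`!)) (q ^ J0) _ _ nodiv); last 2 first.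
  - by rewrite !muln_gt0 d0 expn_gt0 p0 fact_gt0.
  - by rewrite expn_gt0 q0.
  have x0d : x0 * d%:R = (numq x0)%:~R.
    rewrite /d pmulrn absz_denq -{1}(divq_num_den x0) divfK//.
    by rewrite intr_eq0 denq_eq0.
  move=> x [Xx hx]; split => //=.
  rewrite natrM mulrA; case: hx => [->|[j [a [jJ j0 /moran_zero_class_clear e]]]].
    by rewrite x0d rpredM// ?rpred_int ?rpred_nat.
  rewrite -[x](subrK x0) mulrDl mulrDl rpredD//; last first.
    by rewrite x0d rpredM// ?rpred_int ?rpred_nat.
  rewrite mulrAC rpredM ?rpred_nat//.
  have /dvdnP[f Mf] : (K j %| M`!)%N by rewrite dvdn_fact// prime_gt0 ?Np// NM.
  rewrite Mf -(subnKC jJ) expnD.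
  have -> : (p ^ j * p ^ (J - j) * (f * K j))%N%:R =
     (p%:Z ^+ j * (K j)%:Z)%:~R * (p ^ (J - j) * f)%:R :> rat.
    by rewrite intrM rmorphXn /= -!pmulrn !natrM !natrX; ring.
  by rewrite mulrA e rpredM ?rpred_int ?rpred_nat.
have [x0 Xx0] : X !=set0 by apply: infinite_setN0.
have [x1 [Xx1 x10]] : (X `\ x0) !=set0.
  by apply: infinite_setN0; apply: infinite_setD => //; exact: finite_set1.
(* A point x outside both finite sets has indices above J from x0 and from x1. Subtracting the two
   relations shows that q^J divides (x1 - x0) u v, with u and v prime to q. *)
have far J : (J0 <= J)%N -> (q%:Z ^+ J %| numq (x1 - x0))%Z.
  move=> J0J.
  have [x [Xx xn]] : (X `\` (near_ J x0 `|` near_ J x1)) !=set0.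
    by apply: infinite_setN0; apply: infinite_setD => //; rewrite finite_setU; split.
  have rep y : X y -> ~ near_ J y x -> exists j (a : int),
     (J < j)%N /\ (x - y) * (p%:Z ^+ j * (K j)%:Z)%:~R = (q%:Z ^+ j * a)%:~R.
    move=> Xy ny; have xy : x != y by apply/eqP => xy; apply: ny; split => //; left.
    have [j [a [j0 na e]]] := hX _ _ Xx Xy xy.
    exists j, a; split; last exact: moran_zero_class_clear.
    by rewrite ltnNge; apply/negP => jJ; apply: ny; split => //; right; exists j, a.
  have [j [a [Jj e]]] := rep _ Xx0 (fun h => xn (or_introl h)).
  have [k [b [Jk f]]] := rep _ Xx1 (fun h => xn (or_intror h)).
  set w := x1 - x0.
  have wE (u v : int) : (x - x0) * u%:~R = (q%:Z ^+ j * a)%:~R ->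
      (x - x1) * v%:~R = (q%:Z ^+ k * b)%:~R ->
      w * (u * v)%:~R =
      (q%:Z ^+ J * (q%:Z ^+ (j - J) * a * v - q%:Z ^+ (k - J) * b * u))%:~R.
    move=> e' f'; rewrite mulrBr !mulrA -!exprD !subnKC 1?ltnW// rmorphB /=.
    rewrite ![in RHS](intrM _ _ v) ![in RHS](intrM _ _ u) -e' -f' intrM /w.
    by ring.
  have {wE} := wE _ _ e f.
  set u := p%:Z ^+ j * (K j)%:Z; set v := p%:Z ^+ k * (K k)%:Z => wE.
  have cop i : (J < i)%N -> coprimez (q%:Z ^+ J) (p%:Z ^+ i * (K i)%:Z).
    move=> Ji; rewrite coprimezXl// coprimezMr coprimezXr ?coprimezE//=.
      by rewrite Nq// idx// (leq_trans J0J)// ltnW.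
    by rewrite coprime_sym.
  have : (q%:Z ^+ J %| (u * v) * numq w)%Z.
    apply/dvdzP; eexists; rewrite [in RHS]mulrC.
    apply: (@intr_inj rat); rewrite intrM numqE mulrA [_%:~R * w]mulrC wE.
    by rewrite -intrM -mulrA.
  by rewrite Gauss_dvdzr// coprimezMr !cop.
have : numq (x1 - x0) = 0.
  apply/eqP/negPn/negP => n0'.
  (* Since q^J > J, such a power of q cannot divide the nonzero numerator. *)
  pose J := maxn J0 `|numq (x1 - x0)|.
  have := far J (leq_maxl _ _); rewrite -Posz_exp dvdzE /= => /dvdn_leq.
  rewrite absz_gt0 n0' => /(_ isT); rewrite leqNgt => /negP; apply.
  apply: leq_ltn_trans (ltn_expl _ q1); exact: leq_maxr.
by move/eqP; rewrite numq_eq0 subr_eq0 => /eqP.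
Qed.

(** Primes dividing [p] are set aside because the powers p^j bring them into the denominators
    without control. *)
Definition sole_bad_prime (z : rat) (P : nat) : Prop :=
  [/\ prime P, ~~ (P %| p)%N, (P %| denq z)%Z &
      forall Q, prime Q -> ~~ (Q %| p)%N -> Q != P -> ~~ (Q %| denq z)%Z].

Lemma denq_dvd (z : rat) (u v : int) : z * v%:~R = u%:~R -> (denq z %| v)%Z.
Proof.
move=> zv; have e : numq z * v = u * denq z.
  by apply: (@intr_inj rat); rewrite !intrM numqE -zv; ring.
rewrite -(@Gauss_dvdzr _ (numq z)) ?e ?dvdz_mull//.
by rewrite coprimez_sym coprimezE coprime_num_den.
Qed.

Lemma denq_primeB (x y : rat) (P : nat) : prime P ->
  ~~ (P %| denq x)%Z -> ~~ (P %| denq y)%Z -> ~~ (P %| denq (x - y))%Z.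
Proof.
move=> Pp nx ny; apply/negP => /dvdz_trans H.
have /H : (denq (x - y) %| denq x * denq y)%Z.
  apply: (@denq_dvd _ (numq x * denq y - numq y * denq x)).
  by rewrite rmorphB /= !intrM !numqE; ring.
by rewrite dvdz_primeM// (negbTE nx) (negbTE ny).
Qed.

Lemma denqB (x y : rat) : denq (x - y) = denq (y - x).
Proof. by rewrite -opprB denqN. Qed.

(** In a triangle, a prime dividing the denominator of one side divides that of another. If P and Q
    differed, the third side would need both of them as its only bad prime. *)
Lemma sole_bad_prime_vertex (x y z : rat) (P Q S : nat) :
  sole_bad_prime (x - y) P -> sole_bad_prime (x - z) Q ->
  sole_bad_prime (y - z) S -> P = Q.
Proof.
move=> [Pp Pnp Pxy xyP] [Qp Qnp Qxz xzQ] [Sp Snp Syz yzS].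
apply/eqP/negPn/negP => PQ.
have PS : P = S.
  apply/eqP/negPn/negP => PS; have := denq_primeB _ _ _ Pp
    (xzQ _ Pp Pnp PQ) (yzS _ Pp Pnp PS).
  by rewrite (_ : x - z - (y - z) = x - y) ?Pxy//; ring.
have QP : Q != P by rewrite eq_sym.
have QS : Q != S by rewrite -PS.
have := denq_primeB _ _ _ Qp (xyP _ Qp Qnp QP).
move/(_ (z - y)); rewrite denqB => /(_ (yzS _ Qp Qnp QS)).
by rewrite (_ : x - y - (z - y) = x - z) ?Qxz//; ring.
Qed.

Hypothesis Nq : forall n, (0 < n)%N -> coprime q (N n).
Hypothesis Nnp : forall n, (0 < n)%N -> coprime p (N n).

(** The prime is N_n for the index n of the zero: the denominator divides p^j N_n, and N_n survives
    in it because it divides neither q nor a. Multiplying by N_n leaves a divisor of p^j. *)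
Lemma moran_zero_class_sole_bad_prime (z : rat) :
  moran_zero_class c r N s z ->
  exists P, [/\ sole_bad_prime z P, (P <= M)%N & ~~ (P %| denq (z * P%:R))%Z].
Proof.
move=> [j [a [j0 na /moran_zero_class_clear e]]].
have Pp := Np _ j0.
have Pq : ~~ (K j %| q)%N by rewrite -prime_coprime// coprime_sym Nq.
have Pnp : ~~ (K j %| p)%N by rewrite -prime_coprime// coprime_sym Nnp.
exists (K j); split; last 2 first.
- exact: NM.
- apply/negP => /dvdz_trans/(_ (@denq_dvd _ (q%:Z ^+ j * a) (p%:Z ^+ j) _)).
  rewrite -e intrM => /(_ _)/dvdz_primeX; rewrite (negbTE Pnp) => H.
  by apply: notF; apply: H => //; rewrite -pmulrn; ring.
split => //.
- apply/negPn/negP => Pd; move/negP: na; apply.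
  have : (K j %| q%:Z ^+ j * a * denq z)%Z.
    have -> : q%:Z ^+ j * a * denq z = numq z * p%:Z ^+ j * (K j)%:Z.
      by apply: (@intr_inj rat); rewrite intrM -e !intrM numqE; ring.
    by rewrite dvdz_mull.
  rewrite !dvdz_primeM// (negbTE Pd) orbF => /orP[|//].
  by move=> /(dvdz_primeX _ _ _ Pp); rewrite (negbTE Pq).
- move=> Q Qp Qnp QP; apply/negP => /dvdz_trans/(_ (denq_dvd _ _ _ e)).
  rewrite dvdz_primeM// => /orP[/(dvdz_primeX _ _ _ Qp)|].
    by rewrite (negbTE Qnp).
  by rewrite dvdzE /= dvdn_prime2// (negbTE QP).
Qed.

Lemma moran_zero_class_card_le (X : set rat) : (0 < M)%N ->
  (forall x y, X x -> X y -> x != y -> moran_zero_class c r N s (x - y)) ->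
  X #<= `I_M.
Proof.
move=> M0 hX.
have [[x0 [x1 [Xx0 Xx1 x01]]]|nX] :=
    pselect (exists x y, [/\ X x, X y & x != y]); last first.
  exact: card_le_subsingleton.
have bad x y (Xx : X x) (Xy : X y) (xy : x != y) :=
  moran_zero_class_sole_bad_prime _ (hX _ _ Xx Xy xy).
have badC x y P : sole_bad_prime (x - y) P -> sole_bad_prime (y - x) P.
  by rewrite /sole_bad_prime denqB.
have vertex x y z P Q : X x -> X y -> X z -> x != y -> x != z ->
    sole_bad_prime (x - y) P -> sole_bad_prime (x - z) Q -> P = Q.
  move=> Xx Xy Xz xy xz bP bQ; have [yz|yz] := eqVneq y z.
    subst z; move: bP bQ => [Pp Pn Pd uP] [Qp Qn Qd uQ].
    apply/eqP/negPn/negP => PQ.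
    by have := uQ _ Pp Pn PQ; rewrite Pd.
  have [S [bS _ _]] := bad _ _ Xy Xz yz.
  exact: sole_bad_prime_vertex bP bQ bS.
have [P [bP PM _]] := bad _ _ Xx0 Xx1 x01.
(* Every difference has the bad prime of x0 - x1: first those with x0, then x - y by comparison with
   x - x0. *)
have all0 x Q : X x -> x != x0 -> sole_bad_prime (x - x0) Q -> Q = P.
  move=> Xx xx0 bQ; apply: (vertex x0 x x1) => //; first by rewrite eq_sym.
  exact: badC.
have allP x y Q : X x -> X y -> x != y -> sole_bad_prime (x - y) Q -> Q = P.
  move=> Xx Xy xy bQ; have [xx0|xx0] := eqVneq x x0.
    by apply: (all0 y) => //; [rewrite -xx0 eq_sym|rewrite -xx0; exact: badC].
  have [S [bS _ _]] := bad _ _ Xx Xx0 xx0.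
  rewrite -(all0 _ _ Xx xx0 bS); exact: (vertex x y x0).
have Pp : prime P by case: bP.
have PF : P \in [pchar 'F_P] by exact: pchar_Fp.
(* One factor [P] clears P from the denominators, so [w x] has a residue modulo P, one of at most M
   values. *)
pose w x := (x - x0) * P%:R.
have wd x : X x -> ~~ (P %| denq (w x))%Z.
  move=> Xx; rewrite /w; have [->|xx0] := eqVneq x x0.
    rewrite subrr mul0r (_ : denq 0 = 1)// dvdzE /= dvdn1.
    by case: (P) Pp => [|[]].
  have [S [bS _]] := bad _ _ Xx Xx0 xx0.
  by rewrite (all0 _ _ Xx xx0 bS).
pose g x : 'F_P := (numq (w x))%:~R / (denq (w x))%:~R.
apply: (@card_le_inj_on _ _ _ _ (fun x => val (g x))); last first.
  by move=> x Xx; apply: (leq_trans (ltn_ord (g x))); rewrite Fp_cast.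
move=> x y /set_mem Xx /set_mem Xy /val_inj gxy; apply/eqP/negPn/negP => xy.
have d0 z : X z -> (denq (w z))%:~R != 0 :> 'F_P.
  by move=> Xz; rewrite -(dvdz_pcharf PF) wd.
have : (P %| numq (w x) * denq (w y) - numq (w y) * denq (w x))%Z.
  rewrite (dvdz_pcharf PF) rmorphB /= !intrM subr_eq0.
  by have /eqP := gxy; rewrite /g eqr_div ?d0.
move=> /dvdzP[b eb].
have [S [bS _ _]] := bad _ _ Xx Xy xy.
have Pd : (P %| denq (x - y))%Z.
  by rewrite -(allP _ _ _ Xx Xy xy bS); case: bS.
have PR : P%:R != 0 :> rat by rewrite pnatr_eq0 -lt0n prime_gt0.
have : (denq (x - y) %| denq (w x) * denq (w y))%Z.
  apply: (@denq_dvd _ b); apply: (mulIf PR).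
  transitivity ((b * P)%:~R : rat); last by rewrite intrM -pmulrn.
  rewrite -eb rmorphB /= !intrM !numqE /w; ring.
move=> /(dvdz_trans Pd); rewrite dvdz_primeM//.
by rewrite (negbTE (wd _ Xx)) (negbTE (wd _ Xy)).
Qed.

End Classes.
End Rationals.

(** * Explicit orthogonal families *)

Section Families.
Context {R : realType}.
Variables (rho : R) (N : nat -> nat).

Lemma moran_zeroN (t : R) : moran_zero rho N t -> moran_zero rho N (- t).
Proof.
move=> [n [a [n0 na e]]]; exists n, (- a); split => //; first by rewrite rpredN.
by rewrite !mulNr e intrN.
Qed.

Lemma moran_zero_neq0 (t : R) : moran_zero rho N t -> t != 0.
Proof.
move=> [n [a [_ na e]]]; apply: contraNneq na => t0.
by move/eqP: e; rewrite t0 !mul0r eq_sym intr_eq0 => /eqP ->; rewrite dvdz0.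
Qed.

(** Zeros are symmetric, so ordered pairs i < j suffice; zeros are nonzero, so [f] is injective and
    the family has exactly [alpha] points. *)
Lemma moran_zero_family (alpha : nat) (f : nat -> R) :
  (forall i j, (i < j < alpha)%N -> moran_zero rho N (f j - f i)) ->
  f @` `I_alpha #= `I_alpha /\
  forall l l', (f @` `I_alpha) l -> (f @` `I_alpha) l' -> l != l' ->
    moran_zero rho N (l - l').
Proof.
move=> hf.
have H i j : (i < alpha)%N -> (j < alpha)%N -> i != j -> moran_zero rho N (f j - f i).
  move=> ia ja; rewrite neq_ltn => /orP[ij|ji]; first by apply: hf; rewrite ij.
  by rewrite -opprB; apply/moran_zeroN/hf; rewrite ji.
split.
  apply: inj_card_eq => i j /set_mem ia /set_mem ja fij; apply/eqP/negPn/negP => ij.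
  by have := moran_zero_neq0 _ (H _ _ ia ja ij); rewrite fij subrr eqxx.
move=> _ _ [j ja <-] [i ia <-] fij; apply: H => //.
by apply: contra_neq fij => ->.
Qed.

(** All differences are zeros at the single index [n], with numerator j - i strictly between 0 and
    N_n. *)
Lemma moran_zero_arithmetic (n : nat) :
  (0 < n)%N -> (0 < N n)%N -> 0 < rho ->
  forall i j, (i < j < N n)%N ->
  moran_zero rho N (j%:R / (rho ^+ n * (N n)%:R) - i%:R / (rho ^+ n * (N n)%:R)).
Proof.
move=> n0 Nn0 rho0 i j /andP[ij jN]; exists n, (j - i)%N%:Z; split => //.
  rewrite dvdzE /= gtnNdvd ?subn_gt0//.
  by apply: leq_ltn_trans jN; rewrite leq_subr.
rewrite -pmulrn natrB ?(ltnW ij)//; field.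
by rewrite pnatr_eq0 -lt0n Nn0 expf_neq0// gt_eqF.
Qed.

(** The difference is a zero at the larger index (j+1) r. Exponents start at 1 because indices must
    be positive, and q^alpha absorbs every q^(j+1). *)
Lemma moran_zero_geometric (p q r alpha : nat) :
  (0 < p)%N -> (0 < q)%N -> (0 < r)%N -> rho ^+ r = p%:R / q%:R ->
  (forall n, (0 < n)%N -> [/\ prime (N n), ~~ (N n %| q)%N & (N n %| p)%N]) ->
  forall i j, (i < j < alpha)%N ->
  moran_zero rho N (q%:R ^+ alpha / (p%:R ^+ j.+1 * (N (j.+1 * r))%:R) -
                    q%:R ^+ alpha / (p%:R ^+ i.+1 * (N (i.+1 * r))%:R)).
Proof.
move=> p0 q0 r0 rhor hN i j /andP[ij ja].
have jr0 : (0 < j.+1 * r)%N by rewrite muln_gt0.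
have ir0 : (0 < i.+1 * r)%N by rewrite muln_gt0.
have [Pj nPq _] := hN _ jr0.
have [Pi _ /dvdnP[f pf]] := hN _ ir0.
have pR : p%:R != 0 :> R by rewrite pnatr_eq0 -lt0n.
have qR : q%:R != 0 :> R by rewrite pnatr_eq0 -lt0n.
have NiR : (N (i.+1 * r))%:R != 0 :> R by rewrite pnatr_eq0 -lt0n prime_gt0.
have NjR : (N (j.+1 * r))%:R != 0 :> R by rewrite pnatr_eq0 -lt0n prime_gt0.
set Nj := N (j.+1 * r) in Pj nPq NjR *; set Ni := N (i.+1 * r) in Pi pf NiR *.
(* As p = f Ni, [e] is p^(j-i) / Ni. The rescaled difference q^(alpha-j-1) (1 - Nj e) is thus an
   integer, congruent to q^(alpha-j-1) modulo the prime Nj, which does not divide q. *)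
pose e := (p ^ (j - i).-1 * f)%N.
exists (j.+1 * r)%N, (q%:Z ^+ (alpha - j.+1) * (1 - (Nj * e)%N%:Z)); split => //.
  rewrite -/Nj dvdz_primeM// negb_or; apply/andP; split.
    by apply/negP => /(dvdz_primeX _ _ _ Pj); exact/negP.
  apply/negP => d1.
  have : (Nj %| 1 - (Nj * e)%N%:Z + (Nj * e)%N%:Z)%Z.
    by rewrite rpredD// dvdzE /= dvdn_mulr.
  by rewrite subrK dvdzE /= dvdn1 => /eqP Nj1; rewrite Nj1 in Pj.
have eR : (e%:R : R) * Ni%:R = p%:R ^+ (j - i).
  rewrite -natrM /e -mulnA -pf -natrX -expnSr prednK// subn_gt0//.
have -> : rho ^+ (j.+1 * r) = p%:R ^+ j.+1 / q%:R ^+ j.+1.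
  by rewrite mulnC exprM rhor expr_div_n.
have -> : p%:R ^+ j.+1 = e%:R * Ni%:R * p%:R ^+ i.+1 :> R.
  by rewrite eR -exprD addnS subnK// ltnW.
have -> : q%:R ^+ alpha = q%:R ^+ (alpha - j.+1) * q%:R ^+ j.+1 :> R.
  by rewrite -exprD subnK.
have e0 : e%:R != 0 :> R.
  by apply: contraNneq (expf_neq0 (j - i) pR) => e0; rewrite -eR e0 mul0r.
rewrite intrM intrB rmorphXn /= -!pmulrn (natrM _ Nj e) -/Nj; field.
by rewrite NiR NjR e0 !expf_neq0.
Qed.
End Families.

(** * The three assertions for the Moran measure *)

Theorem theorem1p1 (R : realType) (p q r : nat)
    (hp : (0 < p)%N) (hq : (0 < q)%N) (hr : (0 < r)%N) (hpq : gcdn p q = 1%N)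
    (rho : R) (hrho : rho = (p%:R / q%:R) `^ (r%:R^-1)) (hrho1 : rho < 1)
    (hrmin : forall k : nat, (0 < k < r)%N -> ~ rational (rho ^+ k))
    (N : nat -> nat) (hN : forall n : nat, (0 < n)%N -> prime (N n))
    (M : nat) (hM : supremums [set N n | n in [set n : nat | (0 < n)%N]] M)
    (mu : probability (measurableTypeR R) R)
    (hmu : is_moran_measure rho (fun n => digits (N n)) mu) :
  [/\ (exists L : set R, infinite_set L /\ orthogonal_exponentials mu L) ->
        infinite_set [set n : nat | (0 < n)%N /\ (1 < gcdn q (N n))%N],
      (forall n : nat, (0 < n)%N -> gcdn q (N n) = 1%N /\ gcdn p (N n) = 1%N) ->
        (forall L : set R, orthogonal_exponentials mu L -> L #<= `I_M) /\
        (exists L : set R, L #= `I_M /\ orthogonal_exponentials mu L) &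
      (forall n : nat, (0 < n)%N -> gcdn q (N n) = 1%N /\ (1 < gcdn p (N n))%N) ->
        (forall alpha : nat, (0 < alpha)%N ->
           exists L : set R, L #= `I_alpha /\ orthogonal_exponentials mu L) /\
        ~ (exists L : set R, infinite_set L /\ orthogonal_exponentials mu L)].
Proof.
have pR : 0 < p%:R :> R by rewrite ltr0n.
have qR : 0 < q%:R :> R by rewrite ltr0n.
have rho0 : 0 < rho by rewrite hrho powR_gt0// divr_gt0.
have rhor : rho ^+ r = p%:R / q%:R.
  have x0 : 0 <= p%:R / q%:R :> R by rewrite divr_ge0// ltW.
  by rewrite -(powR_mulrn _ (ltW rho0)) hrho -powRrM mulVf ?powRr1// pnatr_eq0 -lt0n.
have q1 : (1 < q)%N.
  have : p%:R / q%:R < 1 :> R by rewrite -rhor exprn_ilt1 ?ltW// -lt0n.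
  by rewrite ltr_pdivrMr// mul1r ltr_nat; apply: leq_ltn_trans.
have cpq : coprime p q by rewrite /coprime hpq.
case: hM => Mub Mlub.
have NM n : (0 < n)%N -> (N n <= M)%N by move=> n0; apply: Mub; exists n.
have N1M n : (0 < n)%N -> (1 < N n <= M)%N.
  by move=> n0; rewrite NM// prime_gt1// hN.
have N0 n : (0 < n)%N -> (0 < N n)%N by move=> /hN/prime_gt0.
have M0 : (0 < M)%N by apply: leq_trans (NM 1%N _); rewrite ?N0.
have orthE (L : set R) : orthogonal_exponentials mu L <->
    forall l l', L l -> L l' -> l != l' -> moran_zero rho N (l - l').
  split=> H l l' Ll Ll' ll'.
  - by have /(moran_fourier_eq0 _ _ _ rho0 hrho1 N1M _ hmu) := H _ _ Ll Ll' ll'.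
  - by apply/(moran_fourier_eq0 _ _ _ rho0 hrho1 N1M _ hmu); exact: H.
have c0 : p%:R / q%:R != 0 :> rat.
  by rewrite mulf_neq0 ?invr_eq0 ?pnatr_eq0 -?lt0n.
have rhorc : rho ^+ r = ratr (p%:R / q%:R) by rewrite rhor fmorph_div /= !ratr_nat.
have single (L : set R) := moran_zero_single_class _ _ _ hr c0 rho0 rhorc hrmin N N0 L.
have partI : (exists L : set R, infinite_set L /\ orthogonal_exponentials mu L) ->
        infinite_set [set n : nat | (0 < n)%N /\ (1 < gcdn q (N n))%N].
  move=> [L [infL /orthE oL]] finq; apply: infL.
  (* A set with at most one point offers no reference difference and is treated separately. *)
  have [[l [l' [Ll Ll' ll']]]|nL] :=
      pselect (exists l l', [/\ L l, L l' & l != l']); last first.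
    exact: (card_le_finite (card_le_subsingleton _ _ 1 isT nL) (finite_II 1)).
  have [|s [X [XL hX]]] := single L _ oL; first by exists l, l'.
  have [n0 Hn0] : exists n0, forall n, (n0 < n)%N -> coprime q (N n).
    have /finite_fsetP[F FE] := finq.
    exists (\max_(n <- F) n) => n Fn.
    rewrite /coprime eqn_leq gcdn_gt0 hq andbT leqNgt; apply/negP => qn.
    have : n \in F.
      have : [set` F] n by rewrite -FE; split => //; apply: leq_ltn_trans Fn.
      by [].
    by move=> nF; move: Fn; rewrite ltnNge leq_bigmax_seq.
  have := moran_zero_class_finite _ _ _ _ _ _ hp q1 hr cpq hN NM _ _ Hn0 hX.
  by apply: card_le_finite; move: XL; rewrite card_eq_le => /andP[].
split; first exact: partI.
- move=> cop; split.
    move=> L /orthE oL.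
    have [[l [l' [Ll Ll' ll']]]|nL] :=
        pselect (exists l l', [/\ L l, L l' & l != l']); last first.
      exact: card_le_subsingleton.
    have [|s [X [XL hX]]] := single L _ oL; first by exists l, l'.
    rewrite -(card_le_eql XL).
    have cq n : (0 < n)%N -> coprime q (N n) by move=> /cop[/eqP].
    have cp n : (0 < n)%N -> coprime p (N n) by move=> /cop[_ /eqP].
    exact: (moran_zero_class_card_le p q r s N M).
  (* The supremum is attained: otherwise M - 1 would be a smaller upper bound of these integers. *)
  have [n [n0 NnM]] : exists n, (0 < n)%N /\ N n = M.
    apply: contrapT => nex.
    have : (M <= M.-1)%N.
      apply: Mlub => _ [n n0 <-]; rewrite leEnat -ltnS prednK//.
      by rewrite ltn_neqAle NM// andbT; apply/eqP => NnM; apply: nex; exists n.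
    by rewrite -ltnS prednK// ltnn.
  have := moran_zero_family _ _ _ _ (moran_zero_arithmetic _ _ n n0 (N0 _ n0) rho0).
  rewrite NnM => -[LM oL]; eexists; split; first exact: LM.
  by apply/orthE.
- move=> cop; split.
    move=> alpha _.
    have H n : (0 < n)%N -> [/\ prime (N n), ~~ (N n %| q)%N & (N n %| p)%N].
      move=> n0; have [cq cp] := cop _ n0; split; first exact: hN.
        by rewrite -prime_coprime ?hN// coprime_sym /coprime cq.
      apply: contraLR cp; rewrite -prime_coprime ?hN// coprime_sym => /eqP ->.
      by [].
    have [La oL] := moran_zero_family _ _ _ _
      (moran_zero_geometric _ _ _ _ _ alpha hp hq hr rhor H).
    by eexists; split; [exact: La|apply/orthE].
  (* An infinite family would contradict (i), since no n has gcd(q, N_n) > 1. *)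
  move=> /partI; apply.
  rewrite (_ : [set n | _] = set0) ?finite_set0// -subset0 => n [n0].
  by have [-> _] := cop _ n0.
Qed.
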